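(* Let $k$ be a non-negative integer. Then: (1) there exists a positive integer $\mathfrak n_0$ such that for every $n\ge\mathfrak n_0$ no $n$-variable monotone Boolean function is $k$-plateaued; (2) there exists a positive integer $\mathfrak n_1$ such that for every $n\ge\mathfrak n_1$ no $n$-variable linear threshold function is $k$-plateaued; (3) for every positive integer $d$ there exists a positive integer $\mathfrak n_2$ (depending on $d$) such that for every $n\ge\mathfrak n_2$ no $n$-variable Boolean function in $\mathrm{AC}^0[d]$ is $k$-plateaued.
   Context: For $f:\{-1,1\}^n\to\{-1,1\}$ and $S\subseteq[n]$, $\widehat f(S)=2^{-n}\sum_{\mathbf x\in\{-1,1\}^n} f(\mathbf x)\prod_{i\in S}x_i$. For $k\in\{0,\dots,n\}$ with $n\equiv k \pmod 2$, $f$ is $k$-plateaued if $\widehat f(S)\in\{0,\pm 2^{-(n-k)/2}\}$ for all $S\subseteq[n]$. $f$ is monotone if $\mathbf a\le\mathbf b$ coordinatewise implies $f(\mathbf a)\le f(\mathbf b)$. $f$ is a linear threshold function if there are reals $w_0,\dots,w_n$ with $f(\mathbf x)=\mathrm{sign}(w_0+w_1x_1+\cdots+w_nx_n)$ for all $\mathbf x$, where $\mathrm{sign}(z)=1$ if $z>0$ and $-1$ if $z\le0$. A depth-$d$ circuit on $n$ variables is a leveled circuit of unbounded fan-in AND and OR gates with inputs $x_1,\dots,x_n,\overline{x}_1,\dots,\overline{x}_n$, with $d$ levels, gates at level $i$ taking inputs only from level $i-1$, all gates on a level of the same type and types alternating between levels; its size is its number of gates. $\mathrm{AC}^0[d]$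 is the set of Boolean functions computable by depth-$d$ circuits whose size is bounded by a (fixed) polynomial in $n$. *)

(* Defs.v *)
From mathcomp Require Import all_boot all_order all_algebra.
From mathcomp Require Import reals.

Set Implicit Arguments.
Unset Strict Implicit.
Unset Printing Implicit Defensive.

Import Order.TTheory GRing.Theory Num.Theory.
Local Open Scope ring_scope.

(* {-1,1} is carried by [bool] and read through [pm]: true is 1, false is -1. *)
Definition pm (R : pzRingType) (b : bool) : R := if b then 1 else -1.

Definition cube (n : nat) := {ffun 'I_n -> bool}.

Definition boolfun (n : nat) := cube n -> bool.

Definition fourier (R : realType) (n : nat) (f : boolfun n) (S : {set 'I_n}) : R :=
  2 ^- n * \sum_(x : cube n) pm R (f x) * \prod_(i in S) pm R (x i).

(* The halving [./2] is exact because of the parity condition. *)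
Definition plateaued (R : realType) (k n : nat) (f : boolfun n) : Prop :=
  [/\ (k <= n)%N,
      n = k %[mod 2]
    & forall S : {set 'I_n},
        [\/ fourier R f S = 0,
            fourier R f S = 2 ^- ((n - k)./2)
          | fourier R f S = - 2 ^- ((n - k)./2)]].

Definition monotone (n : nat) (f : boolfun n) : Prop :=
  forall a b : cube n,
    (forall i : 'I_n, pm int (a i) <= pm int (b i)) -> pm int (f a) <= pm int (f b).

(* Not [Num.sg]: the value at 0 is -1. *)
Definition sign (R : realType) (z : R) : R := if 0 < z then 1 else -1.

Definition linear_threshold (R : realType) (n : nat) (f : boolfun n) : Prop :=
  exists (w0 : R) (w : 'I_n -> R),
    forall x : cube n, pm R (f x) = sign (w0 + \sum_(i < n) w i * pm R (x i)).

(* [circuit n d V]: a leveled circuit with d levels of gates over n variables,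
   whose last level is indexed by V.  Level 0 consists of the 2n literals:
   (i, true) is x_i and (i, false) is its negation.  [Level C wires] puts a new
   level W of gates on top of C; gate g reads the nodes [wires g] of the last
   level of C. *)
Inductive circuit (n : nat) : nat -> finType -> Type :=
| Literals : circuit n 0 ('I_n * bool)%type
| Level (d : nat) (V W : finType) (C : circuit n d V) (wires : W -> {set V}) :
    circuit n d.+1 W.

Fixpoint circuit_size (n d : nat) (V : finType) (C : circuit n d V) : nat :=
  match C with
  | Literals => 0
  | Level _ _ W C' _ => circuit_size C' + #|W|
  end.

(* The Boolean [b] says whether the gates of level 1 are AND gates; the types
   then alternate, so those of level d.+1 are AND gates iff [b (+) odd d].
   A gate with no input is the neutral constant (true for AND, false for OR). *)
Fixpoint circuit_eval (n : nat) (b : bool) (x : cube n) (d : nat) (V : finType)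
    (C : circuit n d V) : V -> bool :=
  match C in circuit _ _ V0 return V0 -> bool with
  | Literals => fun l => x l.1 == l.2
  | Level d' V' _ C' wires => fun g =>
      if b (+) odd d' then [forall u in wires g, circuit_eval b x C' u]
      else [exists u in wires g, circuit_eval b x C' u]
  end.

Definition computable (n d s : nat) (f : boolfun n) : Prop :=
  exists (b : bool) (V : finType) (C : circuit n d V) (out : V),
    (circuit_size C <= s)%N /\ forall x : cube n, f x = circuit_eval b x C out.

(* AC0[d] as a class of n-variable functions makes sense relative to the fixed
   polynomial p bounding the circuit size: AC0[d] is the union over p of the
   classes [AC0 d p] below. *)
Definition AC0 (R : realType) (d : nat) (p : {poly R}) (n : nat) (f : boolfun n) :
    Prop :=
  exists s : nat, s%:R <= p.[n%:R] /\ computable d s f.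

(* Main.v *)
(* The Fourier spectrum of a k-plateaued function is spread so evenly that any
   k+1 coordinates have total influence at least 1/2; hence all but k
   coordinates have influence at least 1/(2(k+1)), and the total influence is
   linear in n.

   A monotone or linear threshold function is unate, so each of its influences
   is the modulus of a Fourier coefficient, which is exponentially small.

   For a circuit of polynomial size and depth d, apply random restrictions that
   keep each variable with a small probability q.  A weak switching lemma turns
   every OR or AND of juntas of bounded size into a junta of bounded size, except
   with inverse polynomial probability.  After d rounds the function f is a
   junta, so its total influence is bounded; since its expectation is q^d times
   the total influence of f, the latter is o(n). *)
Require Import Defs.
From mathcomp Require Import all_boot all_order all_algebra.
From mathcomp Require Import reals.
From mathcomp Require Import ring lra zify.

Set Implicit Arguments.
Unset Strict Implicit.
Unset Printing Implicit Defensive.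

Import Order.TTheory GRing.Theory Num.Theory.
Local Open Scope ring_scope.

(* The pushforward of a product of two product measures under a coordinatewise
   operation is a product measure. *)
Lemma sum_prod_pair (R : comPzRingType) (I T1 T2 T3 : finType)
    (F1 : I -> T1 -> R) (F2 : I -> T2 -> R) (c : I -> T1 -> T2 -> T3)
    (h : {ffun I -> T3} -> R) :
  \sum_(a : {ffun I -> T1}) \sum_(b : {ffun I -> T2})
     (\prod_i F1 i (a i)) * (\prod_i F2 i (b i)) * h [ffun i => c i (a i) (b i)]
  = \sum_(e : {ffun I -> T3})
      (\prod_i \sum_(u | c i u.1 u.2 == e i) F1 i u.1 * F2 i u.2) * h e.
Proof.
under [RHS]eq_bigr => e _ do rewrite bigA_distr_big_dep /= big_distrl /=.
rewrite pair_big [RHS](exchange_big_dep xpredT) // /=.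
pose pr (ab : {ffun I -> T1} * {ffun I -> T2}) : {ffun I -> T1 * T2} :=
  [ffun i => (ab.1 i, ab.2 i)].
pose un (u : {ffun I -> T1 * T2}) := ([ffun i => (u i).1], [ffun i => (u i).2]).
rewrite [RHS](reindex pr) /=; last first.
  exists un => [[a b] _|u _]; last by apply/ffunP=> i; rewrite !ffunE -surjective_pairing.
  by congr pair; apply/ffunP=> i; rewrite !ffunE.
apply: eq_bigr => [[a b]] _ /=.
rewrite (big_pred1 [ffun i => c i (a i) (b i)]) => [|e]; last first.
  apply/familyP/eqP => [cE|-> i]; last by rewrite unfold_in !ffunE.
  by apply/ffunP=> i; move: (cE i); rewrite unfold_in !ffunE => /eqP.
by rewrite -big_split /=; congr (_ * _); apply: eq_bigr => i _; rewrite ffunE.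
Qed.

(** * Fourier analysis on the cube, influences, and plateaued functions *)

Section Fourier.
Variables (R : realType) (n : nat).
Implicit Types (f : boolfun n) (g : cube n -> R) (S J : {set 'I_n}) (i : 'I_n).

Definition chi S (x : cube n) : R := \prod_(i in S) pm R (x i).

Definition fcoef g S : R := 2 ^- n * \sum_x g x * chi S x.

Lemma pm_sqr b : pm R b * pm R b = 1.
Proof. by case: b; rewrite /pm; ring. Qed.

Lemma pm_neq (a b : bool) : a != b -> pm R a = - pm R b.
Proof. by case: a; case: b => //; rewrite /pm opprK. Qed.

(** The sum over [S] factors as the product of the x_i y_i + 1, in which any coordinate where [x]
    and [y] differ contributes 0. *)
Lemma sum_chi (x y : cube n) :
  \sum_S chi S x * chi S y = if x == y then 2 ^+ n else 0.
Proof.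
transitivity (\prod_i (pm R (x i) * pm R (y i) + 1)).
  rewrite bigA_distr; apply: eq_bigr => S _.
  rewrite -big_split /= [LHS]big_mkcond; apply: eq_bigr => i _.
  by case: ifP.
case: eqVneq => [->|].
  under eq_bigr => i _ do rewrite pm_sqr.
  by rewrite prodr_const card_ord.
move=> xy; have [i xyi] : exists i, x i != y i.
  apply/existsP; apply: contraR xy; rewrite negb_exists => /forallP xyE.
  by apply/eqP/ffunP=> i; apply/eqP; rewrite -[_ == _]negbK.
by rewrite (bigD1 i) //= (pm_neq xyi) mulNr pm_sqr addNr mul0r.
Qed.

(** Real-valued [g] is allowed because this is applied to discrete derivatives, which also take the
    value 0. *)
Lemma parseval g : \sum_S fcoef g S ^+ 2 = 2 ^- n * \sum_x g x ^+ 2.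
Proof.
have n2 : (2 : R) ^+ n != 0 by rewrite expf_neq0 ?pnatr_eq0.
transitivity (2 ^- n * 2 ^- n *
   \sum_S \sum_x \sum_y g x * g y * (chi S x * chi S y)).
  rewrite mulr_sumr; apply: eq_bigr => S _.
  rewrite /fcoef exprMn expr2; congr (_ * _).
  rewrite expr2 mulr_suml; apply: eq_bigr => x _.
  by rewrite mulr_sumr; apply: eq_bigr => y _; ring.
rewrite exchange_big -mulrA; congr (_ * _); rewrite mulr_sumr.
apply: eq_bigr => x _; rewrite exchange_big /=.
under eq_bigr => y _ do rewrite -mulr_sumr sum_chi.
rewrite (bigD1 x) //= eqxx big1 => [|y yx]; last by rewrite eq_sym (negPf yx) mulr0.
by field.
Qed.

Definition flip i (x : cube n) : cube n := [ffun j => (j == i) (+) x j].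

Lemma flipK i : involutive (flip i).
Proof. by move=> x; apply/ffunP=> j; rewrite !ffunE addbA addbb. Qed.

Lemma chi_flip S i x : chi S (flip i x) = if i \in S then - chi S x else chi S x.
Proof.
case: ifP => iS.
  rewrite /chi (bigD1 i) //= [in RHS](bigD1 i) //= ffunE eqxx addTb -mulNr.
  congr (_ * _); first by case: (x i); rewrite /pm ?opprK.
  by apply: eq_bigr => j /andP[_ ji]; rewrite ffunE (negPf ji).
apply: eq_bigr => j jS; rewrite ffunE.
by have [ji|//] := eqVneq j i; rewrite -ji jS in iS.
Qed.

Lemma fcoef_flip g S i :
  fcoef (g \o flip i) S = if i \in S then - fcoef g S else fcoef g S.
Proof.
rewrite /fcoef (reindex_inj (inv_inj (flipK i))) /=.
under eq_bigr => x _ do rewrite flipK chi_flip.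
case: ifP => // _; rewrite -mulrN -sumrN; congr (_ * _).
by apply: eq_bigr => x _; rewrite mulrN.
Qed.

Definition influence f i : R := 2 ^- n * \sum_x (f x != f (flip i x))%:R.

(** Parseval for the derivative of [f] in direction [i]: its square is the indicator of sensitivity,
    and it keeps exactly the coefficients with [i] in [S]. *)
Lemma influence_fourier f i :
  influence f i = \sum_(S : {set 'I_n} | i \in S) fourier R f S ^+ 2.
Proof.
pose g x := (pm R (f x) - pm R (f (flip i x))) / 2.
transitivity (\sum_S fcoef g S ^+ 2).
  rewrite parseval; congr (_ * _); apply: eq_bigr => x _; rewrite /g.
  by case: (f x); case: (f _); rewrite /pm /= ?mulr1n ?mulr0n; field.
rewrite [RHS]big_mkcond; apply: eq_bigr => S _.
have -> : fcoef g S = (fcoef (pm R \o f) S - fcoef ((pm R \o f) \o flip i) S) / 2.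
  rewrite /fcoef -mulrBr -sumrB -mulrA mulr_suml; congr (_ * _).
  by apply: eq_bigr => x _; rewrite /g /=; ring.
rewrite fcoef_flip; case: ifP => _; last by rewrite subrr mul0r expr0n.
by rewrite /fourier /fcoef /chi /=; congr (_ ^+ 2); field; rewrite expf_neq0 ?pnatr_eq0.
Qed.

Lemma fourier_sqr_sum f : \sum_S fourier R f S ^+ 2 = 1.
Proof.
rewrite -[LHS]/(\sum_S fcoef (pm R \o f) S ^+ 2) parseval /=.
under eq_bigr => x _ do rewrite expr2 pm_sqr.
by rewrite sumr_const card_ffun card_bool card_ord natrX mulVf ?expf_neq0 ?pnatr_eq0.
Qed.

Lemma plateaued_sqr_le k f S : plateaued R k f -> fourier R f S ^+ 2 <= 2 ^- (n - k).
Proof.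
case=> kn nk /(_ S) fS.
have h : 2 ^- (n - k) = (2 ^- ((n - k)./2)) ^+ 2 :> R.
  by rewrite -!exprVn -exprM muln2; congr (_ ^+ _); lia.
case: fS => ->; rewrite h ?sqrrN // expr0n /=.
by rewrite exprn_ge0 // invr_ge0 exprn_ge0.
Qed.

(* Only the 2^(n-k-1) coefficients off J escape the sum, with total weight at
   most 2^(n-k-1) 2^-(n-k). *)
Lemma plateaued_influence k f J : plateaued R k f -> #|J| = k.+1 ->
  2^-1 <= \sum_(i in J) influence f i.
Proof.
move=> fP cJ; have [kn _ _] := fP.
have kn1 : (k < n)%N by rewrite -cJ -[X in (_ <= X)%N]card_ord max_card.
have le_off : \sum_(S : {set 'I_n} | S \subset ~: J) fourier R f S ^+ 2 <= 2^-1.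
  apply: (@le_trans _ _ (\sum_(S : {set 'I_n} | S \subset ~: J) 2 ^- (n - k))).
    by apply: ler_sum => S _; exact: plateaued_sqr_le.
  rewrite sumr_const (eq_card (B := mem (powerset (~: J)))) => [|S]; last first.
    by rewrite powersetE.
  have -> : #|mem (powerset (~: J))| = (2 ^ (n - k).-1)%N.
    by rewrite card_powerset cardsCs setCK card_ord cJ; congr expn; lia.
  rewrite -(prednK (_ : 0 < n - k)%N) ?subn_gt0 //= -(mulr_natr (2 ^- _)) natrX exprS.
  by rewrite invfM -mulrA mulVf ?mulr1 // expf_neq0 ?pnatr_eq0.
have swap : \sum_(i in J) influence f i =
    \sum_(S : {set 'I_n}) \sum_(i in J | i \in S) fourier R f S ^+ 2.
  under eq_bigr => i _ do rewrite influence_fourier.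
  by rewrite (exchange_big_dep xpredT).
rewrite swap; have := fourier_sqr_sum f.
rewrite (bigID (fun S : {set 'I_n} => S \subset ~: J)) /= => sum1.
rewrite (bigID (fun S : {set 'I_n} => S \subset ~: J)) /= ler_wpDl //.
  by apply: sumr_ge0 => S _; apply: sumr_ge0 => i _; exact: sqr_ge0.
apply: (@le_trans _ _ (\sum_(S : {set 'I_n} | ~~ (S \subset ~: J))
    fourier R f S ^+ 2)).
  by move: le_off sum1; lra.
(* A set [S] meeting [J] is counted once for each common element, hence at least once. *)
apply: ler_sum => S /subsetPn[i iS]; rewrite inE negbK => iJ.
rewrite (bigD1 i) ?iJ //= lerDl; apply: sumr_ge0 => j _; exact: sqr_ge0.
Qed.

(** By [plateaued_influence], at most k coordinates have influence below 1/(2(k+1)); the others, at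
    least n - k of them, give the bound. *)
Lemma plateaued_total_influence k f : plateaued R k f ->
  (n - k)%:R / (2 * k.+1)%:R <= \sum_i influence f i.
Proof.
move=> fP; set e : R := ((2 * k.+1)%:R)^-1.
have e_ge0 : 0 <= e by rewrite invr_ge0 ler0n.
pose L := [set i | influence f i < e].
have inf_ge0 i : 0 <= influence f i.
  by rewrite influence_fourier; apply: sumr_ge0 => S _; exact: sqr_ge0.
have cL : (#|L| <= k)%N.
  rewrite leqNgt; apply/negP => /card_geqP[J [Ju Js JL]].
  have cJ : #|[set i in J]| = k.+1 by rewrite cardsE (card_uniqP Ju).
  have := plateaued_influence fP cJ; apply/negP; rewrite -ltNge.
  have -> : 2^-1 = \sum_(i in [set i in J]) e :> R.
    by rewrite sumr_const cJ -[RHS]mulr_natr /e natrM invfM -mulrA mulVf ?mulr1 ?pnatr_eq0.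
  apply: ltr_sum => [|i]; last by rewrite inE => /JL; rewrite inE.
  by apply/hasP; case: J Js JL {Ju cJ} => // i J _ _; exists i;
     rewrite ?mem_index_enum // inE mem_head.
rewrite (bigID (mem L)) /= ler_wpDl ?sumr_ge0 //.
apply: (@le_trans _ _ (\sum_(i | i \notin L) e)).
  rewrite sumr_const -[leRHS]mulr_natl ler_wpM2r // ler_nat.
  rewrite -(_ : #|~: L| = #|[pred i | i \notin L]|).
    by rewrite cardsCs setCK card_ord leq_sub2l.
  by apply: eq_card => i; rewrite !inE.
by apply: ler_sum => i; rewrite inE -leNgt.
Qed.

(** * Unate functions: monotone and linear threshold functions *)

Definition unate f i : Prop := exists b : bool,
  forall x, f x != f (flip i x) -> f x = b (+) x i.

(** At all points sensitive in direction [i] the product of f(x) and x_i has the same sign, so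
    nothing cancels there; the two points of an insensitive pair cancel each other. *)
Lemma unate_influence f i : unate f i -> influence f i <= `|fourier R f [set i]|.
Proof.
move=> [b fb].
suff -> : fourier R f [set i] = - pm R b * influence f i.
  by rewrite normrM normrN (_ : `|pm R b| = 1) ?mul1r ?ler_norm //; case: (b);
     rewrite /pm ?normrN normr1.
have flipE := fcoef_flip (pm R \o f) [set i] i; rewrite set11 in flipE.
have -> : fourier R f [set i] =
    (fcoef (pm R \o f) [set i] - fcoef ((pm R \o f) \o flip i) [set i]) / 2.
  by rewrite flipE /fourier /fcoef /chi /=; field; rewrite expf_neq0 ?pnatr_eq0.
rewrite /fcoef /influence -mulrBr -sumrB [RHS]mulrCA -mulrA.
congr (_ * _); rewrite mulr_suml mulr_sumr; apply: eq_bigr => x _.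
rewrite /chi big_set1 /=; have := fb x; case: eqVneq => [->|/= ne /(_ isT) fx].
  by rewrite !mulr0 subrr mul0r.
have -> : pm R (f (flip i x)) = - pm R (f x).
  by rewrite (pm_neq ne) opprK.
by rewrite fx; case: (b); case: (x i); rewrite /pm /=; field.
Qed.

(** Where the hypothesis is vacuous at [x], it applies at [flip i x], so both ends of a sensitive
    edge are oriented. *)
Lemma unateI f i b :
  (forall x : cube n, b (+) x i -> f (flip i x) -> f x) -> unate f i.
Proof.
move=> fb; exists b => x; have := fb x; have := fb (flip i x).
rewrite flipK ffunE eqxx addTb -addbN.
by case: (b); case: (x i) => /=; case: (f x); case: (f _) => //= H1 H2 _;
   first [have := H1 isT isT | have := H2 isT isT].
Qed.

Lemma monotone_unate f i : monotone f -> unate f i.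
Proof.
move=> fM; apply: (@unateI _ _ false) => x /= xi.
have := fM (flip i x) x; case: (f x); case: (f _) => //= H _.
by apply: H => j; rewrite ffunE; case: eqVneq => [->|//]; rewrite xi.
Qed.

Lemma linear_threshold_unate f i : linear_threshold R f -> unate f i.
Proof.
(* The sign of the weight gives the direction of monotonicity in x_i. *)
move=> [w0 [w fE]]; apply: (@unateI _ _ (w i < 0)) => x xi.
have f_gt0 y : f y = (0 < w0 + \sum_(i < n) w i * pm R (y i)).
  by have := fE y; rewrite /sign /pm; case: (f y); case: ifP => // _ E; lra.
rewrite !f_gt0 => /lt_le_trans; apply; rewrite lerD2l.
apply: ler_sum => j _; rewrite ffunE; case: eqVneq => [->|//] /=.
by case: ltP xi => wi; case: (x i) => //= _; rewrite /pm; lra.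
Qed.

(** The bound on n gives (n-k)/2 >= k+2, so k+1 influences sum to at most (k+1)/2^(k+2) < 1/2,
    against [plateaued_influence]. *)
Lemma unate_not_plateaued k f : (3 * k + 4 <= n)%N ->
  (forall i, unate f i) -> ~ plateaued R k f.
Proof.
move=> nk fU fP.
have /card_geqP[J [Ju Js _]] : (k.+1 <= #|[set: 'I_n]|)%N.
  by rewrite cardsT card_ord; lia.
have cJ : #|[set i in J]| = k.+1 by rewrite cardsE (card_uniqP Ju).
have := plateaued_influence fP cJ; apply/negP; rewrite -ltNge.
apply: (@le_lt_trans _ _ (\sum_(i in [set i in J]) 2 ^- (k + 2))).
  apply: ler_sum => i _; apply: le_trans (unate_influence (fU i)) _.
  have le_exp : 2 ^- ((n - k)./2) <= 2 ^- (k + 2) :> R.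
    rewrite lef_pV2 ?posrE ?exprn_gt0 // ler_weXn2l ?ler1n //; lia.
  case: fP => _ _ /(_ [set i])[] ->; rewrite ?normrN ?normr0;
    rewrite ?[`|_|]ger0_norm // invr_ge0 exprn_ge0 //.
rewrite sumr_const cJ -[ltLHS]mulr_natl addn2 exprS invfM mulrCA.
rewrite -[ltRHS]mulr1 ltr_pM2l ?invr_gt0 // ltr_pdivrMr ?exprn_gt0 // mul1r.
by rewrite -natrX ltr_nat ltn_expl.
Qed.

End Fourier.

(** * Random restrictions and their effect on influences *)

Section Restriction.
Variables (R : realType) (n : nat).
Implicit Types (f : boolfun n) (V J A : {set 'I_n}) (i : 'I_n).

(** [None] is a star: the variable stays free. *)
Definition restriction := {ffun 'I_n -> option bool}.
Implicit Types rho tau : restriction.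

Definition fill rho (x : cube n) : cube n := [ffun i => odflt (x i) (rho i)].

Definition wt (p : R) (a : option bool) : R := if a is Some _ then (1 - p) / 2 else p.

Definition expect p (h : restriction -> R) : R :=
  \sum_(rho : restriction) (\prod_i wt p (rho i)) * h rho.

Lemma sum_option_bool (F : option bool -> R) :
  \sum_a F a = F None + F (Some true) + F (Some false).
Proof.
rewrite (bigD1 None) //= (bigD1 (Some true)) //= (bigD1 (Some false)) //=.
by rewrite big1 ?addr0 ?addrA // => -[[]|].
Qed.

Lemma sum_pair_if (T1 T2 : finType) (P : T1 -> T2 -> bool) (F : T1 -> T2 -> R) :
  \sum_(u | P u.1 u.2) F u.1 u.2 = \sum_a \sum_b if P a b then F a b else 0.
Proof. by rewrite big_mkcond pair_big. Qed.

Lemma expect_prod p (F : 'I_n -> option bool -> R) :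
  expect p (fun rho => \prod_i F i (rho i)) = \prod_i \sum_a wt p a * F i a.
Proof.
rewrite bigA_distr_bigA; apply: eq_bigr => rho _; by rewrite big_split.
Qed.

Lemma sum_wt p : \sum_a wt p a = 1.
Proof. by rewrite sum_option_bool /=; field. Qed.

Lemma expect1 p c : expect p (fun=> c) = c.
Proof.
rewrite /expect -mulr_suml -[RHS]mul1r; congr (_ * _).
rewrite -(bigA_distr_bigA (fun i => wt p)).
by rewrite big1 // => i _; exact: sum_wt.
Qed.

Lemma eq_expect p h1 h2 : h1 =1 h2 -> expect p h1 = expect p h2.
Proof. by move=> h12; apply: eq_bigr => rho _; rewrite h12. Qed.

Lemma expectD p h1 h2 :
  expect p (fun rho => h1 rho + h2 rho) = expect p h1 + expect p h2.
Proof. by rewrite -big_split; apply: eq_bigr => rho _; rewrite mulrDr. Qed.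

Lemma expectZ p c h : expect p (fun rho => c * h rho) = c * expect p h.
Proof. by rewrite mulr_sumr; apply: eq_bigr => rho _; rewrite mulrCA. Qed.

Lemma expect_sum p (I : finType) (P : pred I) (h : I -> restriction -> R) :
  expect p (fun rho => \sum_(j | P j) h j rho) = \sum_(j | P j) expect p (h j).
Proof. by rewrite exchange_big; apply: eq_bigr => rho _; rewrite mulr_sumr. Qed.

Lemma wt_ge0 p a : 0 <= p <= 1 -> 0 <= wt p a.
Proof. by case: a => [?|] /andP[p0 p1] //=; lra. Qed.

Lemma ler_expect p h1 h2 : 0 <= p <= 1 -> (forall rho, h1 rho <= h2 rho) ->
  expect p h1 <= expect p h2.
Proof.
move=> p01 h12; apply: ler_sum => rho _; apply: ler_wpM2l => //.
by apply: prodr_ge0 => i _; exact: wt_ge0.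
Qed.

Definition compose (a b : option bool) := if a is Some _ then a else b.

Lemma fill_compose rho tau x :
  fill [ffun i => compose (rho i) (tau i)] x = fill rho (fill tau x).
Proof. by apply/ffunP=> i; rewrite !ffunE; case: (rho i). Qed.

(** A variable stays free iff it is starred in both draws, with probability [p * q], and the two
    constants remain equally likely. Successive rounds thus amount to one restriction. *)
Lemma expect_compose p q h :
  expect p (fun rho => expect q (fun tau => h [ffun i => compose (rho i) (tau i)]))
  = expect (p * q) h.
Proof.
transitivity (\sum_(rho : restriction) \sum_(tau : restriction)
    (\prod_i wt p (rho i)) * (\prod_i wt q (tau i)) *
    h [ffun i => compose (rho i) (tau i)]).
  apply: eq_bigr => rho _; rewrite mulr_sumr; apply: eq_bigr => tau _.
  by rewrite mulrA.
rewrite (sum_prod_pair (fun=> wt p) (fun=> wt q) (fun=> compose)).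
apply: eq_bigr => e _; congr (_ * _); apply: eq_bigr => i _.
rewrite (sum_pair_if (fun a b => compose a b == e i)
  (fun a b => wt p a * wt q b)) /=.
rewrite !sum_option_bool /=.
by case: (e i) => [[]|] /=; field.
Qed.

Definition splice V tau rho : restriction :=
  [ffun i => if i \in V then tau i else rho i].

(** Coordinates are independent, so those in [V] can be exposed before the others. *)
Lemma expect_splice p V h :
  expect p (fun tau => expect p (fun rho => h (splice V tau rho))) = expect p h.
Proof.
transitivity (\sum_(tau : restriction) \sum_(rho : restriction)
    (\prod_i wt p (tau i)) * (\prod_i wt p (rho i)) * h (splice V tau rho)).
  apply: eq_bigr => tau _; rewrite mulr_sumr; apply: eq_bigr => rho _.
  by rewrite mulrA.
rewrite (sum_prod_pair (fun=> wt p) (fun=> wt p)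
  (fun i a b => if i \in V then a else b)).
apply: eq_bigr => e _; congr (_ * _); apply: eq_bigr => i _.
rewrite (sum_pair_if (fun a b => (if i \in V then a else b) == e i)
  (fun a b => wt p a * wt p b)) /=.
rewrite !sum_option_bool /=.
by case: (e i) => [[]|] /=; case: (i \in V) => /=; field.
Qed.

Definition restrict rho f : boolfun n := fun x => f (fill rho x).

(** Flipping [i] is invisible after the restriction unless [i] is starred, and a random restriction
    filled with a uniform point is a uniform point. *)
Lemma expect_influence p f i :
  expect p (fun rho => influence R (restrict rho f) i) = p * influence R f i.
Proof.
pose s x : R := (f x != f (flip i x))%:R.
(* The implication factors multiply to the indicator of a star at [i], so the weight remains a
   product; the product of ones is the weight of [x], as [sum_prod_pair] requires. *)
transitivity (2 ^- n * \sum_(rho : restriction) \sum_(x : cube n)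
    (\prod_j (wt p (rho j) * ((j == i) ==> (rho j == None))%:R)) * (\prod_(j < n) 1) *
    s [ffun j => odflt (x j) (rho j)]).
  rewrite mulr_sumr; apply: eq_bigr => rho _; rewrite /influence mulrCA mulr_sumr.
  congr (_ * _); apply: eq_bigr => x _.
  rewrite [X in _ * X * _]big1_eq mulr1 big_split -mulrA.
  congr (_ * _); rewrite (bigD1 i) //= eqxx implyTb big1 => [|j /negPf->//].
  rewrite mulr1 /s /restrict -/(fill rho x).
  case: (rho i =P None) => [rhoi|/eqP rhoi]; rewrite ?mul1r ?mul0r.
    suff -> : fill rho (flip i x) = flip i (fill rho x) by [].
    apply/ffunP=> j; rewrite !ffunE.
    by case: eqVneq => [->|]; rewrite ?rhoi ?ffunE ?eqxx // => /negPf->.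
  suff -> : fill rho (flip i x) = fill rho x by rewrite eqxx.
  apply/ffunP=> j; rewrite !ffunE; case: eqVneq => [->|//].
  by case: (rho i) rhoi.
rewrite (sum_prod_pair (fun j a => wt p a * ((j == i) ==> (a == None))%:R)
   (fun _ _ => 1) (fun _ a b => odflt b a)) /influence mulrCA; congr (_ * _).
rewrite mulr_sumr; apply: eq_bigr => y _; congr (_ * _).
(* Off [i], the value [y j] comes from a constant (weight 1 - p) or from a filled star (weight p);
   at [i] only the star counts. *)
have sumE j : \sum_(u : option bool * bool | odflt u.2 u.1 == y j)
   wt p u.1 * ((j == i) ==> (u.1 == None))%:R * 1 = if j == i then p else 1.
  rewrite (sum_pair_if (fun a b => odflt b a == y j)
    (fun a b => wt p a * ((j == i) ==> (a == None))%:R * 1)) /=.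
  rewrite sum_option_bool !big_bool /=.
  by case: (y j); case: (j == i) => /=; field.
under eq_bigr => j _ do rewrite sumE.
by rewrite (bigD1 i) //= eqxx big1 ?mulr1 // => j /negPf->.
Qed.
End Restriction.

(** * Juntas and the rank of a function *)

Section Juntas.
Variable n : nat.
Implicit Types (f g : boolfun n) (V J A : {set 'I_n}) (i : 'I_n) (c x y : cube n).

Definition depends_on V f :=
  [forall x : cube n, forall y : cube n,
    [forall i in V, x i == y i] ==> (f x == f y)].

Lemma depends_onP V f :
  reflect (forall x y, {in V, x =1 y} -> f x = f y) (depends_on V f).
Proof.
apply: (iffP forallP) => [H x y xy|H x].
  have /forallP/(_ y)/implyP/(_ _)/eqP := H x; apply.
  by apply/forall_inP => i /xy->.
apply/forallP => y; apply/implyP => /forall_inP xy.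
by apply/eqP/H => i /xy/eqP.
Qed.

Lemma depends_onT f : depends_on setT f.
Proof.
by apply/depends_onP => x y xy; congr f; apply/ffunP=> i; apply: xy; rewrite inE.
Qed.

(* The shift by one makes the rank submultiplicative in [rank_fix]. *)
Definition rank f : nat := #|[arg min_(V < setT | depends_on V f) #|V| ]|.+1.

Lemma rank_witness f : exists2 V, depends_on V f & rank f = #|V|.+1.
Proof.
by rewrite /rank; case: arg_minnP => [|V fV _]; [exact: depends_onT|exists V].
Qed.

Lemma rank_le V f : depends_on V f -> (rank f <= #|V|.+1)%N.
Proof.
by rewrite /rank; case: arg_minnP => [|W _ min]; [exact: depends_onT|exact: min].
Qed.

Lemma eq_rank f g : f =1 g -> rank f = rank g.
Proof.
move=> fg; suff le f1 f2 : f1 =1 f2 -> (rank f1 <= rank f2)%N.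
  by apply/eqP; rewrite eqn_leq !le // => x; rewrite fg.
move=> f12; have [V /depends_onP fV ->] := rank_witness f2.
by apply: rank_le; apply/depends_onP => x y xy; rewrite !f12; exact: fV.
Qed.

Lemma rank_neg f : rank (fun x => ~~ f x) = rank f.
Proof.
suff le g : (rank (fun x => ~~ g x) <= rank g)%N.
  apply/eqP; rewrite eqn_leq le /=.
  by rewrite -[leqLHS](@eq_rank (fun x => ~~ ~~ f x)) // => x; rewrite negbK.
have [V /depends_onP fV ->] := rank_witness g.
by apply: rank_le; apply/depends_onP => x y xy; rewrite (fV x y).
Qed.

Lemma rank_const f b : (forall x, f x = b) -> rank f = 1%N.
Proof.
move=> fb; apply/eqP; rewrite eqn_leq ltn0Sn andbT -(cards0 'I_n).
by apply: rank_le; apply/depends_onP => x y _; rewrite !fb.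
Qed.

Definition fix_on V c x : cube n := [ffun i => if i \in V then c i else x i].

(** Let r be the largest rank left by an assignment to [J]. The set [J] and minimal supports for all
    2^|J| assignments together support [f], and |J| + 2^|J| (r - 1) < 2^|J| r. *)
Lemma rank_fix J f : exists2 A : {set 'I_n}, A \subset J &
  (rank f <= 2 ^ #|J| * rank (fun x => f (fix_on J [ffun i => i \in A] x)))%N.
Proof.
pose fA A : boolfun n := fun x => f (fix_on J [ffun i => i \in A] x).
have [A AJ Amax] : exists2 A : {set 'I_n}, A \subset J &
    forall B : {set 'I_n}, B \subset J -> (rank (fA B) <= rank (fA A))%N.
  case: (@arg_maxnP _ set0 (fun B : {set 'I_n} => B \subset J)
    (fun B => rank (fA B)) (sub0set J)) => A AJ Amax.
  by exists A.
exists A => //; rewrite -/(fA A).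
pose W B := [arg min_(V < setT | depends_on V (fA B)) #|V| ].
have WE B : depends_on (W B) (fA B) /\ rank (fA B) = #|W B|.+1.
  rewrite /rank -/(W B); split=> //.
  by rewrite /W; case: arg_minnP => [|V fV _]; [exact: depends_onT|].
pose V := J :|: \bigcup_(B in powerset J) W B.
have fV : depends_on V f.
  apply/depends_onP => x y xy.
  pose B := [set i in J | x i].
  have fixE (z : cube n) : {in J, x =1 z} -> z = fix_on J [ffun i => i \in B] z.
    move=> xz; apply/ffunP=> i; rewrite !ffunE.
    by case: ifP => // iJ; rewrite ?ffunE inE iJ xz.
  rewrite (fixE x) // (fixE y) => [|i iJ]; last by apply: xy; rewrite inE iJ.
  have [/depends_onP WB _] := WE B; apply: (WB x y) => i iW.
  apply: xy; rewrite inE; apply/orP; right; apply/bigcupP; exists B => //.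
  by rewrite powersetE; apply/subsetP => j; rewrite inE => /andP[].
apply: leq_trans (rank_le fV) _.
have cV : (#|V| <= #|J| + 2 ^ #|J| * (rank (fA A)).-1)%N.
  apply: leq_trans (leq_card_setU _ _) _; rewrite leq_add2l.
  rewrite -card_powerset -sum_nat_const.
  apply: leq_trans (_ : \sum_(B in powerset J) #|W B| <= _)%N.
    elim/big_ind2: _ => [|X1 m1 X2 m2 h1 h2|//]; first by rewrite cards0.
    exact: leq_trans (leq_card_setU _ _) (leq_add h1 h2).
  apply: leq_sum => B; rewrite powersetE => /Amax.
  by have [_ ->] := WE B; case: (rank (fA A)).
have rk0 : (0 < rank (fA A))%N by [].
have J2 : (#|J| < 2 ^ #|J|)%N by rewrite ltn_expl.
case: (rank (fA A)) rk0 cV => // m _ /= cV; rewrite mulnS.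
by apply: leq_trans (leq_add J2 (leqnn _)); rewrite addSn ltnS.
Qed.

(** The maximum over [A] is replaced by a sum, which commutes with expectation. *)
Lemma rank_fix_sum J f t : (rank f ^ t <= 2 ^ (#|J| * t) *
  \sum_(A in powerset J) rank (fun x => f (fix_on J [ffun i => i \in A] x)) ^ t)%N.
Proof.
have [A AJ fA] := rank_fix J f.
rewrite (bigD1 A) ?powersetE //= mulnDr.
apply: leq_trans (leq_addr _ _); rewrite expnM -expnMn.
by case: t => [|t]; rewrite ?expn0 ?leq_exp2r.
Qed.
End Juntas.

(** * A weak switching lemma for disjunctions of juntas *)

Section Switching.
Variables (R : realType) (n : nat).
Implicit Types (f : boolfun n) (V J A : {set 'I_n}) (i : 'I_n) (c x y : cube n).
Implicit Types (rho tau : restriction n).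

Definition starred V tau : {set 'I_n} := [set i in V | tau i == None].

Definition completion tau A : cube n := [ffun i => odflt (i \in A) (tau i)].

(** Once the stars of [tau] in [V] are filled by [A], all of [V] is fixed; what remains is an
    independent [rho] acting on a function with [V] fixed, to which induction applies. *)
Lemma restrict_splice V tau rho f A x :
  restrict (splice V tau rho) f (fix_on (starred V tau) [ffun i => i \in A] x)
  = restrict rho (fun y => f (fix_on V (completion tau A) y)) x.
Proof.
congr f; apply/ffunP=> i; rewrite !ffunE inE.
by case: (i \in V) => /=; case: (tau i) => //= /[!eqxx].
Qed.

Definition star_prob (b t : nat) : R := 2 ^- (t + 2 + 3 * b).

Lemma star_prob01 b t : 0 <= star_prob b t <= 1.
Proof.
rewrite invr_ge0 exprn_ge0 //= invf_le1 ?exprn_gt0 // exprn_ege1 // ler1n //.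
Qed.

(** Convexity: the power lies below its chord on [0, 1]. *)
Lemma Bernoulli_upper (d : R) b : 0 <= d <= 1 -> (1 + d) ^+ b <= 1 + (2 ^+ b - 1) * d.
Proof.
move=> /andP[d0 d1]; elim: b => [|b IH]; first by rewrite !expr0; lra.
rewrite !exprS; apply: le_trans (ler_wpM2l _ IH) _; first by lra.
have b1 : 1 <= (2 : R) ^+ b by rewrite exprn_ege1 // ler1n.
have : 0 <= (2 ^+ b - 1) * d * (1 - d) by rewrite !mulr_ge0 ?subr_ge0.
by lra.
Qed.

(** The star probability is tuned so that the first power is at most 1 + 4^-b / 2, while the second
    is at least 4^-b: the excess over 2 is exactly absorbed. *)
Lemma switching_numeric b t (v : nat) : (v <= b)%N ->
  2 * (1 - star_prob b t + star_prob b t * 2 ^+ t.+1) ^+ v -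
    ((1 - star_prob b t) / 2) ^+ v <= 2.
Proof.
move=> vb; have /andP[p0 p1] := star_prob01 b t.
set d := 2^-1 * 8 ^- b : R.
have dE : star_prob b t * 2 ^+ t.+1 = d.
  rewrite /star_prob /d exprD (exprD _ t 2) (exprM _ 3 b) (exprS _ t).
  have -> : 2 ^+ 3 = 8 :> R by ring.
  by field; rewrite !expf_neq0 ?pnatr_eq0.
have d01 : 0 <= d <= 1.
  have := exprn_ege1 b (_ : 1 <= (8 : R)); rewrite ler1n => /(_ isT) e8.
  have : 8 ^- b <= 1 :> R by rewrite invf_le1 // exprn_gt0.
  have : 0 <= 8 ^- b :> R by rewrite invr_ge0 exprn_ge0.
  by rewrite /d; lra.
have up : (1 - star_prob b t + star_prob b t * 2 ^+ t.+1) ^+ v <= 1 + 2^-1 * 4 ^- b.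
  rewrite dE; apply: (@le_trans _ _ ((1 + d) ^+ b)).
    apply: (@le_trans _ _ ((1 + d) ^+ v)).
      by rewrite lerXn2r ?nnegrE; lra.
    by rewrite ler_weXn2l //; lra.
  apply: le_trans (Bernoulli_upper b d01) _; rewrite lerD2l.
  apply: (@le_trans _ _ (2 ^+ b * d)); first by rewrite ler_wpM2r; lra.
  rewrite /d mulrCA ler_pM2l ?invr_gt0 ?ltr0n // -!exprVn -exprMn.
  by rewrite lerXn2r ?nnegrE; lra.
have low : 4 ^- b <= ((1 - star_prob b t) / 2) ^+ v.
  have p2 : star_prob b t <= 2^-1.
    rewrite /star_prob lef_pV2 ?posrE ?exprn_gt0 // -[leLHS]expr1 ler_weXn2l ?ler1n //; lia.
  apply: (@le_trans _ _ (4^-1 ^+ v)).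
    by rewrite -exprVn ler_wiXn2l //; lra.
  by rewrite lerXn2r ?nnegrE; lra.
by move: up low; lra.
Qed.

Definition or_seq (U : Type) (l : seq U) (G : U -> boolfun n) : boolfun n :=
  fun x => has (fun u => G u x) l.

(** A t-th moment, so that Markov's inequality bounds the probability of a rank above 2^s by a
    multiple of 2^-(s t). *)
Definition rank_moment b t f : R :=
  expect (star_prob b t) (fun rho => (rank (restrict rho f) ^ t)%:R).

Lemma eq_rank_moment b t f g : f =1 g -> rank_moment b t f = rank_moment b t g.
Proof.
move=> fg; apply: eq_expect => rho.
rewrite (@eq_rank _ _ (restrict rho g)) // => x; exact: fg.
Qed.

Lemma rank_moment_const b t f e : (forall x, f x = e) -> rank_moment b t f = 1.
Proof.
move=> fc; rewrite -[RHS](expect1 n (star_prob b t)); apply: eq_expect => rho.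
by rewrite (@rank_const _ _ e) ?exp1n // => x; exact: fc.
Qed.

(* Once the variables of one disjunct are exposed, either the disjunct is
   satisfied (probability at least 4^-b, and the rank drops to 1) or each of
   the s starred ones costs a factor 2^t in the moment, compensated by the
   probability of a star. *)
Lemma or_seq_moment b t (U : Type) (l : seq U) (G : U -> boolfun n) :
  (forall u, exists2 V : {set 'I_n}, (#|V| <= b)%N & depends_on V (G u)) ->
  rank_moment b t (or_seq l G) <= 2.
Proof.
elim: l G => [|u l IH] G GV.
  by rewrite (@rank_moment_const _ _ _ false) // ler1n.
have [V Vb /depends_onP fV] := GV u.
case: (pickP (fun c => G u c)) => [c Guc|Gu0]; last first.
  rewrite (@eq_rank_moment _ _ _ (or_seq l G)); first exact: IH.
  by move=> x; rewrite /or_seq /= Gu0.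
set F := or_seq _ _.
(* Fixing [V] makes the first disjunct constant: either the disjunction becomes true, or a shorter
   one with juntas no larger remains. *)
have fixed_le d : rank_moment b t (fun x => F (fix_on V d x)) <= 2.
  have Gu x : G u (fix_on V d x) = G u d.
    by apply: fV => i iV; rewrite ffunE iV.
  case: (boolP (G u d)) => Gud.
    rewrite (@rank_moment_const _ _ _ true) ?ler1n // => x.
    by rewrite /F /or_seq /= Gu Gud.
  pose G' u x := G u (fix_on V d x).
  rewrite (@eq_rank_moment _ _ _ (or_seq l G')) => [|x]; last first.
    by rewrite /F /or_seq /= Gu (negPf Gud).
  apply: IH => u'; have [W Wb /depends_onP W'] := GV u'; exists W => //.
  apply/depends_onP => x y xy; apply: W' => i iW; rewrite !ffunE.
  by case: ifP => // _; exact: xy.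
(* Each star in [V] costs 2^t by [rank_fix_sum] and 2 for its membership in [A]. The product of the
   [K2] is the indicator that [tau] agrees with the satisfying [c] on [V]. *)
pose K1 i (a : option bool) : R := if (i \in V) && (a == None) then 2 ^+ t.+1 else 1.
pose K2 i (a : option bool) : R := if i \in V then (a == Some (c i))%:R else 1.
have split_tau tau :
    expect (star_prob b t) (fun rho => (rank (restrict (splice V tau rho) F) ^ t)%:R)
    <= 2 * \prod_i K1 i (tau i) - \prod_i K2 i (tau i).
  (* If [tau] satisfies the disjunct, the rank is 1 and the bound is 2 - 1. *)
  case: (boolP [forall i in V, tau i == Some (c i)]) => [/forall_inP sat|].
    rewrite !big1 => [|i _|i _]; last 2 first.
    - by rewrite /K2; case: ifP => // /sat->.
    - by rewrite /K1; case: ifP => // /andP[/sat/eqP->].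
    rewrite (@eq_expect _ _ _ _ (fun=> 1)) ?expect1; first by lra.
    move=> rho; rewrite (@rank_const _ _ true) ?exp1n // => x.
    rewrite /restrict /F /or_seq /= (fV _ c) ?Guc // => i iV.
    by rewrite !ffunE iV (eqP (sat i iV)).
  rewrite negb_forall => /existsP[j]; rewrite negb_imply => /andP[jV tauj].
  rewrite [X in _ - X](bigD1 j) //= {1}/K2 jV (negPf tauj) mul0r subr0.
  set S := starred V tau.
  have -> : \prod_i K1 i (tau i) = (2 ^ (#|S| * t.+1))%:R.
    rewrite natrX mulnC exprM -big_mkcond /= prodr_const.
    by congr (_ ^+ _); apply: eq_card => i; rewrite inE.
  apply: (@le_trans _ _ (expect (star_prob b t) (fun rho => (2 ^ (#|S| * t))%:R *
      \sum_(A in powerset S)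
        (rank (restrict rho (fun y => F (fix_on V (completion tau A) y))) ^ t)%:R))).
    apply: ler_expect => [|rho]; first exact: star_prob01.
    rewrite -natr_sum -natrM ler_nat.
    apply: leq_trans (rank_fix_sum S _ t) _; rewrite leq_mul2l leq_sum ?orbT // => A _.
    by rewrite (eq_rank (restrict_splice V tau rho F A)).
  rewrite expectZ expect_sum mulnS expnD natrM [2 * _]mulrC mulrAC [leLHS]mulrC.
  rewrite ler_wpM2r ?ler0n // -card_powerset mulr_natl -sumr_const.
  by apply: ler_sum => A _; exact: fixed_le.
rewrite /rank_moment -(expect_splice _ V).
apply: le_trans (ler_expect (star_prob01 b t) split_tau) _.
have -> : expect (star_prob b t)
      (fun tau => 2 * \prod_i K1 i (tau i) - \prod_i K2 i (tau i)) =
    2 * (1 - star_prob b t + star_prob b t * 2 ^+ t.+1) ^+ #|V| -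
    ((1 - star_prob b t) / 2) ^+ #|V|.
  under eq_expect => tau do rewrite -mulN1r.
  rewrite expectD !expectZ !expect_prod mulN1r; congr (2 * _ - _).
    rewrite -prodr_const [RHS]big_mkcond; apply: eq_bigr => i _.
    by rewrite sum_option_bool /K1; case: (i \in V) => /=; field.
  rewrite -prodr_const [RHS]big_mkcond; apply: eq_bigr => i _.
  rewrite sum_option_bool /K2 /=; case: ifP => _ /=; last by field.
  by case: (c i); rewrite /= ; field.
exact: switching_numeric.
Qed.
End Switching.

(** * Circuits under random restrictions *)

Section Circuits.
Variables (R : realType) (n : nat).
Implicit Types (f : boolfun n) (rho tau : restriction n).

Lemma rank_moment_neg b t f : rank_moment R b t (fun x => ~~ f x) = rank_moment R b t f.
Proof. by apply: eq_expect => rho; rewrite -[in RHS]rank_neg. Qed.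

Lemma exists_moment b t (U : finType) (A : {set U}) (G : U -> boolfun n) :
  (forall u, exists2 V : {set 'I_n}, (#|V| <= b)%N & depends_on V (G u)) ->
  rank_moment R b t (fun x => [exists u in A, G u x]) <= 2.
Proof.
move=> GV; rewrite (@eq_rank_moment _ _ _ _ _ (or_seq (enum A) G)).
  exact: or_seq_moment.
move=> x; apply/exists_inP/hasP => -[u uA Gu]; exists u => //.
  by rewrite mem_enum.
by rewrite -mem_enum.
Qed.

Lemma forall_moment b t (U : finType) (A : {set U}) (G : U -> boolfun n) :
  (forall u, exists2 V : {set 'I_n}, (#|V| <= b)%N & depends_on V (G u)) ->
  rank_moment R b t (fun x => [forall u in A, G u x]) <= 2.
Proof.
move=> GV; rewrite -rank_moment_neg.
rewrite (@eq_rank_moment _ _ _ _ _ (fun x => [exists u in A, ~~ G u x])).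
  apply: (exists_moment t A (G := fun u x => ~~ G u x)) => u.
  have [V Vb /depends_onP GuV] := GV u; exists V => //.
  by apply/depends_onP => x y xy; rewrite (GuV x y).
by move=> x; rewrite negb_forall_in.
Qed.

(** After [rho] the inputs of the gate are juntas, so one more restriction controls the gate,
    whatever its fan-in. *)
Lemma gate_moment b t e d (U W : finType) (C : circuit n d U) (wires : W -> {set U})
    rho (g : W) :
  (forall u, (rank (restrict rho (fun x => circuit_eval e x C u)) <= b)%N) ->
  rank_moment R b t (restrict rho (fun x => circuit_eval e x (Level C wires) g)) <= 2.
Proof.
move=> Cb.
have CV u : exists2 V : {set 'I_n}, (#|V| <= b)%N &
    depends_on V (restrict rho (fun x => circuit_eval e x C u)).
  have [V CV rkV] := rank_witness (restrict rho (fun x => circuit_eval e x C u)).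
  by exists V => //; rewrite ltnW // -rkV.
rewrite /restrict /=; case: (e (+) odd d); [exact: forall_moment|exact: exists_moment].
Qed.

Lemma literals_rank e rho u :
  (rank (restrict rho (fun x => circuit_eval e x (Literals n) u)) <= 2)%N.
Proof.
rewrite -[2%N]/(1.+1) -(cards1 u.1); apply: rank_le.
apply/depends_onP => x y xy; rewrite /restrict /= !ffunE xy //; exact: set11.
Qed.

Definition complex_gate s e d (U : finType) (C : circuit n d U) rho : bool :=
  [exists u, 2 ^ s < rank (restrict rho (fun x => circuit_eval e x C u))]%N.

(** Induction on the depth, with one restriction per level: Markov's inequality for each gate and a
    union bound over the level. Positive [s] accommodates the literals, of rank at most 2. *)
Lemma complex_gate_prob s t e d (U : finType) (C : circuit n d U) : (0 < s)%N ->
  expect (star_prob R (2 ^ s) t ^+ d) (fun rho => (complex_gate s e C rho)%:R)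
  <= (circuit_size C)%:R * (2 / (2 ^+ s) ^+ t).
Proof.
move=> s0; elim: d U / C => [|d U W C IH wires].
  rewrite (@eq_expect _ _ _ _ (fun=> 0)) ?expect1 ?mul0r // => rho.
  suff /negPf-> : ~~ complex_gate s e (Literals n) rho by [].
  apply/existsPn => u; rewrite -leqNgt (leq_trans (literals_rank _ _ _)) //.
  by rewrite -[leqLHS]expn1 leq_exp2l.
set p := star_prob R (2 ^ s) t; set q := 2 / _.
have p01 : 0 <= p <= 1 by exact: star_prob01.
have q0 : 0 <= q by rewrite divr_ge0 ?exprn_ge0.
rewrite exprSr -expect_compose /= natrD mulrDl.
apply: (@le_trans _ _ (expect (p ^+ d)
  (fun rho => (complex_gate s e C rho)%:R + #|W|%:R * q))); last first.
  by rewrite expectD expect1 lerD2r.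
have pd01 : 0 <= p ^+ d <= 1.
  by case/andP: p01 => p0 p1; rewrite exprn_ge0 //= exprn_ile1.
apply: ler_expect => // rho.
have restrictE tau f : restrict [ffun i => compose (rho i) (tau i)] f
    =1 restrict tau (restrict rho f) by move=> x; rewrite /restrict fill_compose.
(* If the previous level already fails, the trivial bound 1 is paid by the first term. *)
case: (boolP (complex_gate s e C rho)) => [_|/existsPn Cb].
  apply: (@le_trans _ _ 1); last by rewrite lerDl mulr_ge0.
  rewrite -[leRHS](expect1 n p); apply: ler_expect => // tau.
  by case: complex_gate; rewrite ?ler01.
rewrite add0r; pose rk tau g := rank (restrict tau (restrict rho
  (fun x => circuit_eval e x (Level C wires) g))).
(* A gate of rank above 2^s makes its own summand at least 1. *)
apply: (@le_trans _ _ (expect p (fun tau =>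
   \sum_(g : W) ((2 ^+ s) ^+ t)^-1 * (rk tau g ^ t)%:R))).
  apply: ler_expect => // tau; case: (boolP (complex_gate _ _ _ _)) => [|_].
    case/existsP => g; rewrite (eq_rank (restrictE tau _)) -/(rk tau g) => big.
    rewrite (bigD1 g) //= ler_wpDr //.
      by apply: sumr_ge0 => h _; rewrite mulr_ge0 ?invr_ge0 ?exprn_ge0.
    rewrite mulrC ler_pdivlMr ?exprn_gt0 // mul1r -!natrX ler_nat.
    by case: (t) => // t'; rewrite leq_exp2r // ltnW.
  by apply: sumr_ge0 => h _; rewrite mulr_ge0 ?invr_ge0 ?exprn_ge0.
rewrite expect_sum -[#|W|]/#|xpredT : pred W| mulr_natl -sumr_const.
apply: ler_sum => g _; rewrite expectZ /q mulrC ler_wpM2r ?invr_ge0 ?exprn_ge0 //.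
by apply: gate_moment => u; rewrite leqNgt; exact: Cb.
Qed.

Lemma influence_le1 f i : influence R f i <= 1.
Proof.
rewrite /influence mulrC ler_pdivrMr ?exprn_gt0 // mul1r.
apply: (@le_trans _ _ (\sum_(x : cube n) 1)).
  by apply: ler_sum => x _; case: (_ != _); rewrite ?ler01.
by rewrite sumr_const card_ffun card_bool card_ord -natrX.
Qed.

Lemma influence_eq0 f (V : {set 'I_n}) i : depends_on V f -> i \notin V ->
  influence R f i = 0.
Proof.
move=> /depends_onP fV iV; rewrite /influence big1 ?mulr0 // => x _.
rewrite (fV x (flip i x)) ?eqxx // => j jV; rewrite ffunE.
by case: eqVneq jV iV => // -> ->.
Qed.

Lemma total_influence_le_rank f : \sum_i influence R f i <= (rank f)%:R.
Proof.
have [V fV ->] := rank_witness f.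
rewrite (bigID (mem V)) /= [X in _ + X]big1 => [|i]; last exact: influence_eq0.
rewrite addr0 (@le_trans _ _ (\sum_(i in V) 1)) //.
  by apply: ler_sum => i _; exact: influence_le1.
by rewrite sumr_const ler_nat.
Qed.

Lemma total_influence_le_dim f : \sum_i influence R f i <= n%:R.
Proof.
rewrite (@le_trans _ _ (\sum_(i < n) 1)) //.
  by apply: ler_sum => i _; exact: influence_le1.
by rewrite sumr_const card_ord.
Qed.

(** The left side is the expected total influence after restriction. It is at most the rank, hence
    2^s, when no gate of the last level is complex, and at most n otherwise. *)
Lemma computable_influence s t d m f : (0 < s)%N -> computable d m f ->
  star_prob R (2 ^ s) t ^+ d * \sum_i influence R f i
  <= (2 ^ s)%:R + n%:R * (m%:R * (2 / (2 ^+ s) ^+ t)).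
Proof.
move=> s0 [e [U [C [out [Cm fE]]]]]; set P := _ ^+ d.
have P01 : 0 <= P <= 1.
  by case/andP: (star_prob01 R (2 ^ s) t) => p0 p1; rewrite exprn_ge0 //= exprn_ile1.
have -> : P * \sum_i influence R f i =
    expect P (fun rho => \sum_i influence R (restrict rho f) i).
  by rewrite expect_sum mulr_sumr; apply: eq_bigr => i _; rewrite expect_influence.
apply: (@le_trans _ _ (expect P
  (fun rho => (2 ^ s)%:R + n%:R * (complex_gate s e C rho)%:R))).
  apply: ler_expect => // rho; case: (boolP (complex_gate _ _ _ _)) => Cs.
    by rewrite mulr1 ler_wpDl // total_influence_le_dim.
  rewrite mulr0 addr0; apply: le_trans (total_influence_le_rank _) _.
  rewrite ler_nat (@eq_rank _ _ (restrict rho (fun x => circuit_eval e x C out))).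
    by rewrite leqNgt; move/existsPn: Cs; apply.
  by move=> x; rewrite /restrict fE.
rewrite expectD expect1 lerD2l expectZ ler_wpM2l //.
apply: le_trans (complex_gate_prob _ _ _ s0) _.
by rewrite ler_wpM2r ?divr_ge0 ?exprn_ge0 // ler_nat.
Qed.

End Circuits.

(** * Choice of parameters and asymptotics *)

Lemma poly_le_monomial (R : realType) (p : {poly R}) :
  exists K : nat, forall n : nat, (0 < n)%N -> p.[n%:R] <= (K * n ^ size p)%:R.
Proof.
exists (Num.bound (\sum_(i < size p) `|p`_i|)) => n n0.
rewrite natrM horner_coef.
apply: (@le_trans _ _ ((\sum_(i < size p) `|p`_i|) * (n ^ size p)%:R)).
  rewrite mulr_suml; apply: ler_sum => i _.
  apply: le_trans (ler_norm _) _; rewrite normrM ler_wpM2l //.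
  rewrite ger0_norm ?exprn_ge0 // -natrX ler_nat leq_pexp2l //; exact: ltnW.
rewrite ler_wpM2r // ltW //.
by apply: le_lt_trans (archi_boundP _); rewrite ?sumr_ge0.
Qed.

Lemma AC0_not_plateaued (R : realType) (k d : nat) (p : {poly R}) :
  exists n2 : nat, (0 < n2)%N /\
    forall n : nat, (n2 <= n)%N ->
    forall f : boolfun n, AC0 d p f -> ~ plateaued R k f.
Proof.
have [K pK] := poly_le_monomial p.
(* The aim is total influence O(n^(d/D)). This [s] makes n^(size p + 1) <= 2^s 2^(s t) for the [t]
   below, so the failure term is at most the summand [2 * K * 2 ^ s] of [M]; [u] is the part of the
   exponent of [star_prob] free of [t]. *)
pose D := d.+1; pose s := (D * (size p).+1)%N.
pose M := (2 ^ s + 2 * K * 2 ^ s)%N; pose u := (2 + 3 * 2 ^ s)%N.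
pose T := (4 * k.+1 * M * 2 ^ (u * d))%N.
(* The first term forces T <= t, the second n <= 2(n - k). *)
exists (2 ^ (T * D) + 2 * k)%N; split=> [|n nT f [m [mp fm]] fP].
  by rewrite addn_gt0 expn_gt0.
have n0 : (0 < n)%N by apply: leq_trans nT; rewrite addn_gt0 expn_gt0.
(* 2^t is about n^(1/D), so d rounds cost about n^(d/D), short of n by a factor 2^t. *)
pose t := (trunc_log 2 n %/ D)%N.
have tn : (2 ^ (t * D) <= n)%N.
  apply: leq_trans _ (trunc_logP (isT : 1 < 2)%N n0).
  by rewrite leq_exp2l // leq_trunc_div.
have nt : (n < 2 ^ (t.+1 * D))%N.
  apply: leq_trans (trunc_log_ltn n (isT : 1 < 2)%N) _.
  by rewrite leq_exp2l // ltn_ceil.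
have Tt : (T <= t)%N.
  rewrite leq_divRL // trunc_log_max //.
  exact: leq_trans (leq_addr _ _) nT.
have mK : (m <= K * n ^ size p)%N by rewrite -(ler_nat R) (le_trans mp) ?pK.
have nm : (n * m * 2 <= 2 * K * 2 ^ s * 2 ^ (s * t))%N.
  have : (n * m <= K * n ^ (size p).+1)%N.
    by rewrite expnS mulnCA leq_mul2l mK orbT.
  have : (n ^ (size p).+1 <= 2 ^ s * 2 ^ (s * t))%N.
    rewrite -expnD -mulnS /s mulnAC expnM leq_exp2r // mulnC ltnW //.
  move=> h1 h2; have := leq_mul (leqnn K) h1; nia.
have upper : 2 ^- ((t + u) * d) * \sum_i influence R f i <= M%:R.
  have := computable_influence R t (isT : 0 < s)%N fm.
  have -> : star_prob R (2 ^ s) t ^+ d = 2 ^- ((t + u) * d).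
    by rewrite /star_prob -addnA -/u exprVn -exprM.
  move=> /le_trans; apply.
  rewrite natrD lerD2l mulrA mulrA ler_pdivrMr ?exprn_gt0 //.
  by rewrite -!exprM -!natrX -!natrM ler_nat.
have := plateaued_total_influence fP; apply/negP; rewrite -ltNge.
have {}upper : \sum_i influence R f i <= (M * 2 ^ ((t + u) * d))%:R.
  by move: upper; rewrite mulrC ler_pdivrMr ?exprn_gt0 // natrM natrX.
apply: le_lt_trans upper _; rewrite ltr_pdivlMr ?ltr0n // -natrM ltr_nat.
have nk : (n <= 2 * (n - k))%N by lia.
(* After division by 2^(t d) this reads T < 2^t. *)
suff : (2 * (M * 2 ^ ((t + u) * d) * (2 * k.+1)) < 2 ^ (t * D))%N by lia.
rewrite (mulnDl t u d) expnD (mulnS t d) expnD.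
have -> : (2 * (M * (2 ^ (t * d) * 2 ^ (u * d)) * (2 * k.+1)) = T * 2 ^ (t * d))%N.
  by rewrite /T; ring.
rewrite ltn_pmul2r ?expn_gt0 //; exact: leq_ltn_trans Tt (ltn_expl _ _).
Qed.

Theorem theorem2 (R : realType) (k : nat) :
  [/\ exists n0 : nat, (0 < n0)%N /\
        forall n : nat, (n0 <= n)%N ->
        forall f : boolfun n, monotone f -> ~ plateaued R k f,
      exists n1 : nat, (0 < n1)%N /\
        forall n : nat, (n1 <= n)%N ->
        forall f : boolfun n, linear_threshold R f -> ~ plateaued R k f
    & forall d : nat, (0 < d)%N ->
      forall p : {poly R},
      exists n2 : nat, (0 < n2)%N /\
        forall n : nat, (n2 <= n)%N ->
        forall f : boolfun n, AC0 d p f -> ~ plateaued R k f].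
Proof.
split.
- exists (3 * k + 4)%N; split=> [|n nk f fM]; first by rewrite addnS.
  by apply: unate_not_plateaued => // i; exact: monotone_unate.
- exists (3 * k + 4)%N; split=> [|n nk f fL]; first by rewrite addnS.
  by apply: unate_not_plateaued => // i; exact: linear_threshold_unate fL.
- by move=> d _ p; exact: AC0_not_plateaued.
Qed.
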